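(* The following streaming certification schemes exist: (i) a certification scheme for $\mathrm{MaxMatching}_{\geq}$ with certificate size $O(k\log n)$ bits and verifier's space complexity $O(\log n)$ bits, for all $n$-node graphs and thresholds $k\geq 1$; (ii) a certification scheme for $\mathrm{MaxMatching}_{\geq}$ with certificate size $O(n\log\Delta)$ bits and verifier's space complexity $O(n)$ bits, for all $n$-node graphs of maximum degree $\Delta$; (iii) a certification scheme for $\mathrm{MaxMatching}_{\leq}$ with certificate size $O(n)$ bits and verifier's space complexity $O(n\log n)$ bits, for all $n$-node graphs.
   Context: Inputs are an $n$-node graph $G$ on vertex set $[n]$ together with an integer threshold $k$; the threshold $k$ is given first, and then the edges of $G$ arrive as a stream (each edge a pair of vertices) in an arbitrary, possibly adversarial, order. A streaming certification scheme for a decision problem $P$ consists of a prover and a verifier. The prover is a computationally unlimited function which, for each input, produces a certificate $c\in\{0,1\}^*$ depending only on the input (not on the order of the edges in the stream). The verifier is a deterministic streaming algorithm that has read-only access to $c$, processes the edge stream, and outputs accept or reject at the end. Completeness: if the input satisfies $P$, there is a certificate $c$ such that for every order of the edges the verifier accepts. Soundness: if the input does not satisfy $P$, then for every certificate $c$ and every order of the edges the verifier rejects. The certificate size is the length of the certificates used by the prover on yes-instances, and the verifier's space complexity is the memory used by the verifier, not counting the read-only certificate. $\mathrm{MaxMatching}_{\geq}$ (resp. $\mathrm{MaxMatching}_{\leq}$) asks whether the size of a maximum matching of $G$ is at least $k$ (resp. at most $k$). *)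

(* Defs.v *)
From mathcomp Require Import all_boot all_order all_algebra.
Set Implicit Arguments.
Unset Strict Implicit.
Unset Printing Implicit Defensive.

Record sgraph (n : nat) := SGraph {
  edges : {set {set 'I_n}};
  edges_card2 : forall e, e \in edges -> #|e| = 2
}.

Definition max_degree n (G : sgraph n) : nat :=
  \max_(v : 'I_n) #|[set e in edges G | v \in e]|.

Definition is_matching n (G : sgraph n) (M : {set {set 'I_n}}) : bool :=
  (M \subset edges G) && trivIset M.

Definition matching_number n (G : sgraph n) : nat :=
  \max_(M : {set {set 'I_n}} | is_matching G M) #|M|.

Definition problem := forall n, sgraph n -> int -> Prop.

Definition MaxMatching_ge : problem :=
  fun n G k => (k <= (matching_number G)%:Z)%R.

Definition MaxMatching_le : problem :=
  fun n G k => ((matching_number G)%:Z <= k)%R.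

(* Every edge arrives exactly once, in an arbitrary order and with its two
   endpoints listed in either order. *)
Definition edge_stream n (G : sgraph n) (es : seq ('I_n * 'I_n)) : bool :=
  perm_eq [seq [set p.1; p.2] | p <- es] (enum (edges G)).

(* One elementary step of a verifier whose memory has type S.  [ReadCert i f]
   queries the certificate bit at position i and moves to [f (Some b)], or to
   [f None] past the end of the certificate; [ReadEdge f] consumes the next
   edge of the stream, [f None] being taken when the stream is exhausted. *)
Variant action (n : nat) (S : Type) :=
  | ReadCert of nat & (option bool -> S)
  | ReadEdge of (option ('I_n * 'I_n) -> S)
  | Output of bool.

Arguments Output {n S} _.

(* A deterministic streaming algorithm on n-node graphs with s bits of memory.
   The threshold comes first and determines the initial memory.  The
   certificate can only be inspected one bit at a time, at a position computed
   from the memory, so the s bits also pay for pointers into the certificate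
   and for all work done between two edges; only the certificate is free.  As
   usual for streaming space bounds, the transition rule is any function and
   may depend on n. *)
Record verifier (n s : nat) := Verifier {
  start : int -> s.-tuple bool;
  act : s.-tuple bool -> action n (s.-tuple bool)
}.

(* [run V c m es b]: from memory m, with certificate c and remaining stream es,
   V halts with output b; output is possible only once the whole stream has
   been read.  A diverging V has no output at all. *)
Inductive run n s (V : verifier n s) (c : seq bool) :
    s.-tuple bool -> seq ('I_n * 'I_n) -> bool -> Prop :=
  | RunCert m i f es b :
      act V m = ReadCert n i f -> run V c (f (onth c i)) es b ->
      run V c m es b
  | RunEdge m f e es b :
      act V m = ReadEdge f -> run V c (f (Some e)) es b ->
      run V c m (e :: es) b
  | RunEnd m f b :
      act V m = ReadEdge f -> run V c (f None) [::] b ->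
      run V c m [::] b
  | RunOutput m b :
      act V m = Output b -> run V c m [::] b.

Definition accepts n s (V : verifier n s) (k : int) c es : Prop :=
  run V c (start V k) es true.

Definition rejects n s (V : verifier n s) (k : int) c es : Prop :=
  run V c (start V k) es false.

(* The number of nodes is known to the verifier; its space [space n] may depend
   on nothing else, whereas the prover sees the whole input. *)
Record scheme (P : problem) := Scheme {
  space : nat -> nat;
  ver : forall n, verifier n (space n);
  prover : forall n, sgraph n -> int -> seq bool;
  completeness : forall n (G : sgraph n) k, P n G k ->
    forall es, edge_stream G es -> accepts (ver n) k (prover G k) es;
  soundness : forall n (G : sgraph n) k, ~ P n G k ->
    forall c es, edge_stream G es -> rejects (ver n) k c es
}.

(* The two O-bounds: one constant for all n >= 2, thresholds and graphs.  (At
   n = 1 a bound such as n log n is 0 and leaves no room for the threshold.)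
   The size of the certificates matters only on yes-instances. *)
Definition cert_size_O (P : problem) (S : scheme P)
    (valid : int -> Prop) (f : forall n, sgraph n -> int -> nat) : Prop :=
  exists C : nat, forall n (G : sgraph n) k,
    1 < n -> valid k -> P n G k -> size (prover S G k) <= C * f n G k.

Definition space_O (P : problem) (S : scheme P) (g : nat -> nat) : Prop :=
  exists C : nat, forall n, 1 < n -> space S n <= C * g n.

Definition log2 (n : nat) : nat := trunc_log 2 n.

(* Main.v *)
(* Every verifier below scans a bounded part of the certificate at each edge,
   so that it is a finite automaton whose space is the logarithm of its number
   of states.

   (i) The certificate lists [k] disjoint edges.  A streamed edge is counted
   when it is the only listed edge that it meets; for an arbitrary certificate
   the counted edges form a matching, and no separate check that the listed
   edges are disjoint is needed.

   (ii) Contract a maximum matching [M] and color the resulting graph greedily: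
   its degrees are at most [2 * Delta], so [O(log Delta)] bits per vertex
   describe a coloring in which an edge joins vertices of the same color
   exactly when it belongs to [M].  The verifier marks the ends of the
   monochromatic edges and rejects when a vertex is marked twice.

   (iii) By the Tutte-Berge formula, twice the matching number is the minimum
   over [U] of [n + #|U| - odd (G - U)].  The certificate is an optimal [U], and
   the verifier maintains the components of [G - U].  A set [U] which is maximal
   among those with [nu (G - U) + #|U| <= nu G] leaves no vertex of [G - U]
   covered by all maximum matchings; by Gallai's lemma "no maximum matching
   misses both [u] and [v]" is then an equivalence relation, every class of
   which is odd if a fixed maximum matching misses one of its vertices. *)
Require Import Defs.
From mathcomp Require Import all_boot all_order all_algebra zify.
Set Implicit Arguments.
Unset Strict Implicit.
Unset Printing Implicit Defensive.

(** * Verifiers that scan the certificate *)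

Section Compile.
Variables (n : nat) (S : finType).

Lemma leq_card_memory : #|S| <= #|{: (up_log 2 #|S|).-tuple bool}|.
Proof. by rewrite card_tuple card_bool up_logP. Qed.

Definition encode (m : S) : (up_log 2 #|S|).-tuple bool :=
  enum_val (widen_ord leq_card_memory (enum_rank m)).

Lemma encode_inj : injective encode.
Proof.
move=> m m' /enum_val_inj /(congr1 val) /= eq_rank.
exact/enum_rank_inj/val_inj.
Qed.

Definition encode_action (a : action n S) :
    action n ((up_log 2 #|S|).-tuple bool) :=
  match a with
  | ReadCert i f => ReadCert n i (encode \o f)
  | ReadEdge f => ReadEdge (encode \o f)
  | Output b => Output b
  end.

(** Bit strings that encode no state are never reached from [start]; [Output false] is a default for
    them. *)
Definition compile (init : int -> S) (trans : S -> action n S) :=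
  {| start := encode \o init;
     act := fun x => if [pick m | encode m == x] is Some m
                     then encode_action (trans m) else Output false |}.

Lemma act_compile init trans m :
  act (compile init trans) (encode m) = encode_action (trans m).
Proof.
rewrite /=; case: pickP => [m' /eqP/encode_inj -> //|/(_ m)].
by rewrite eqxx.
Qed.

End Compile.

(* A verifier which, at every edge and once more at the end of the stream,
   scans the first [nwords] words of the certificate, of [width.+1] bits each
   and padded with [false] past its end. *)
Record scanner (n : nat) := Scanner {
  state : finType;
  acc : finType;
  width : nat;
  nwords : nat;
  init : int -> state;
  acc0 : acc;
  upd : state -> option ('I_n * 'I_n) -> acc -> nat -> width.+1.-tuple bool ->
        acc;
  step : state -> 'I_n * 'I_n -> acc -> state;
  out : state -> acc -> bool
}.

Definition word w (c : seq bool) i : w.-tuple bool :=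
  [tuple nth false c (i * w + j) | j < w].

Section ScannerRun.
Variables (n : nat) (A : scanner n).
Implicit Types (t : state A) (oe : option ('I_n * 'I_n)) (c : seq bool).

Definition scan c t oe :=
  foldl (fun a i => upd t oe a i (word (width A).+1 c i)) (acc0 A)
        (iota 0 (nwords A)).

Definition stream_state c t es :=
  foldl (fun t e => step t e (scan c t (Some e))) t es.

Definition result k c es :=
  let t := stream_state c (init A k) es in out t (scan c t None).

Let w := (width A).+1.
Let N := nwords A * w.

(** In order: the scanner state, the pending edge, a flag raised at the end of the stream, the
    accumulator with the last [w] bits read, and the position in the certificate. *)
Definition memory : finType :=
  (state A * option ('I_n * 'I_n) * bool * (acc A * w.-tuple bool) *
    'I_N.+1)%type.

Definition push (buf : w.-tuple bool) b : w.-tuple bool :=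
  [tuple nth b buf j.+1 | j < w].

Definition buf0 : w.-tuple bool := [tuple false | j < w].

Definition scanner_init k : memory :=
  (init A k, None, false, (acc0 A, buf0), ord0).

(** An edge takes effect only when the next one is requested, once its scan is complete. The scan
    made before the first edge is discarded, no edge being pending then. *)
Definition scanner_trans (m : memory) : action n memory :=
  let: (t, oe, ended, (a, buf), i) := m in
  if i < N then
    ReadCert n i (fun b =>
      let buf' := push buf (odflt false b) in
      (t, oe, ended,
       (if w %| i.+1 then upd t oe a (i %/ w) buf' else a, buf'), inord i.+1))
  else if ended then Output (out t a)
  else ReadEdge (fun oe' =>
    let t' := if oe is Some e then step t e a else t in
    (t', oe', ~~ oe', (acc0 A, buf0), ord0)).

Definition scanner_verifier := compile scanner_init scanner_trans.

Let run_from c m es b := run scanner_verifier c (encode m) es b.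

(* The last [w] bits read, as a window on the certificate that starts with
   [w] padding bits. *)
Let window c i : w.-tuple bool :=
  [tuple (w <= i + j) && nth false c (i + j - w) | j < w].

Lemma push_window c i : push (window c i) (nth false c i) = window c i.+1.
Proof.
apply: eq_from_tnth => j; rewrite !tnth_mktuple.
have := ltn_ord j; rewrite leq_eqVlt => /orP[/eqP wj|lt_jw].
  rewrite nth_default ?size_tuple ?wj // addSnnS wj leq_addl /=.
  by rewrite addnK.
by rewrite -(tnth_nth _ _ (Ordinal lt_jw)) tnth_mktuple /= addSnnS.
Qed.

Lemma window_word c i : window c (i.+1 * w) = word w c i.
Proof.
apply: eq_from_tnth => j; rewrite !tnth_mktuple.
by rewrite mulSn -addnA leq_addr addKn.
Qed.

Let scan_upto c t oe i :=
  foldl (fun a i => upd t oe a i (word w c i)) (acc0 A) (iota 0 (i %/ w)).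

Lemma run_scan c t oe ended es b :
  run_from c (t, oe, ended, (scan c t oe, window c N), ord_max) es b ->
  run_from c (t, oe, ended, (acc0 A, buf0), ord0) es b.
Proof.
pose at_pos i : memory :=
  (t, oe, ended, (scan_upto c t oe i, window c i), inord i).
have -> : (t, oe, ended, (acc0 A, buf0), ord0) = at_pos 0.
  congr (_, (_, _), _).
    by apply: eq_from_tnth => j; rewrite !tnth_mktuple add0n leqNgt ltn_ord.
  by apply: val_inj; rewrite /= inordK.
have -> : (t, oe, ended, (scan c t oe, window c N), ord_max) = at_pos N.
  congr (_, (_, _), _); first by rewrite /scan_upto mulnK.
  by apply: val_inj; rewrite /= inordK.
(* A run is built from its end, so the induction shows that a run from position [i] extends
   backwards to one from position 0. *)
have: N <= N by []; move: {1 3}N => i.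
elim: i => [//|i IHi] lt_iN run_i; apply: IHi; first exact: ltnW.
apply: RunCert; first by rewrite act_compile /= inordK ?lt_iN // ltnW.
rewrite /= odflt_onth push_window.
suff <- : scan_upto c t oe i.+1 = if w %| i.+1 then
    upd t oe (scan_upto c t oe i) (i %/ w) (window c i.+1)
  else scan_upto c t oe i by [].
rewrite /scan_upto divnS //; case: ifP => [/dvdnP[q def_i]|_]; last by [].
have def_q : q = (i %/ w).+1.
  by rewrite -[LHS](@mulnK _ w) // -def_i divnS // def_i dvdn_mull.
by rewrite addnC iotaD foldl_cat def_i def_q window_word.
Qed.

Lemma run_scanner k c es :
  run scanner_verifier c (start scanner_verifier k) es (result k c es).
Proof.
(* The claim is generalized over the pending edge; [flush] applies its delayed effect. *)
pose flush t oe := if oe is Some e then step t e (scan c t oe) else t.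
suff gen oe t : let t' := stream_state c (flush t oe) es in
    run_from c (t, oe, false, (acc0 A, buf0), ord0) es
      (out t' (scan c t' None)).
  exact: gen None (init A k).
elim: es oe t => [|e es IHes] oe t; apply: run_scan.
  apply: RunEnd; first by rewrite act_compile /= ltnn.
  by apply: run_scan; apply: RunOutput; rewrite act_compile /= ltnn.
apply: RunEdge; first by rewrite act_compile /= ltnn.
exact: (IHes (Some e) (flush t oe)).
Qed.

End ScannerRun.

Definition of_words w m (f : nat -> w.-tuple bool) : seq bool :=
  mkseq (fun p => nth false (f (p %/ w)) (p %% w)) (m * w).

Lemma size_of_words w m f : size (@of_words w m f) = m * w.
Proof. exact: size_mkseq. Qed.

Lemma word_of_words w m f i :
  word w (of_words m f) i = if i < m then f i else [tuple false | j < w].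
Proof.
apply: eq_from_tnth => j; rewrite tnth_mktuple.
have w_gt0 : 0 < w by apply: leq_ltn_trans (ltn_ord j).
case: ltnP => [lt_im|le_mi]; last first.
  rewrite tnth_mktuple nth_default // size_of_words.
  by apply: leq_trans (leq_addr _ _); rewrite leq_mul2r le_mi orbT.
rewrite nth_mkseq; last first.
  by apply: leq_trans (leq_mul lt_im (leqnn w)); rewrite mulSn addnC ltn_add2r.
by rewrite divnMDl // divn_small // addn0 modnMDl modn_small // -tnth_nth.
Qed.

Section ScannerScheme.
Variables (P : problem) (A : forall n, scanner n).
Variable prove : forall n, sgraph n -> int -> seq bool.

Hypothesis complete_scan : forall n (G : sgraph n) k, P G k ->
  forall es, edge_stream G es -> result (A n) k (prove G k) es.
Hypothesis sound_scan : forall n (G : sgraph n) k c es,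
  edge_stream G es -> result (A n) k c es -> P G k.

(** A scanner halts on every input, so it rejects whenever it does not accept. The definition is
    transparent because the size and space bounds must unfold it. *)
Definition scanner_scheme : scheme P.
Proof.
refine (@Scheme P _ (fun n => scanner_verifier (A n)) (@prove) _ _).
  move=> n G k PGk es Ges.
  by have := run_scanner (A n) k (prove G k) es; rewrite complete_scan.
move=> n G k notP c es Ges; have := run_scanner (A n) k c es.
by case: result (sound_scan (k := k) (c := c) Ges) => // /(_ isT).
Defined.

End ScannerScheme.

Lemma up_logM a b : up_log 2 (a * b) <= up_log 2 a + up_log 2 b.
Proof. by rewrite up_log_min // expnD leq_mul // up_logP. Qed.

Lemma up_log_memory n (A : scanner n) :
  up_log 2 #|memory A| <= up_log 2 #|state A| + up_log 2 (n * n).+1 +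
    up_log 2 #|acc A| + (width A).+1 +
    up_log 2 (nwords A * (width A).+1).+1 + 1.
Proof.
rewrite !card_prod card_option !card_prod !card_ord card_bool card_tuple
  card_bool.
set s := #|state A|; set e := (n * n).+1; set a := #|acc A|.
set w := (width A).+1; set N := (nwords A * w).+1.
have := up_logM (s * e * 2 * (a * 2 ^ w)) N.
have := up_logM (s * e * 2) (a * 2 ^ w).
have := up_logM (s * e) 2; have := up_logM s e; have := up_logM a (2 ^ w).
have -> : up_log 2 2 = 1 by [].
rewrite up_expnK //; lia.
Qed.

(** * Matchings and the Tutte-Berge formula *)

Section PairSets.
Variable T : finType.
Implicit Types (M : {set {set T}}) (e C : {set T}) (x y : T).

Lemma eq_pair e x y : #|e| = 2 -> x \in e -> y \in e -> x != y ->
  e = [set x; y].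
Proof.
move=> e2 xe ye xy; apply/esym/eqP; rewrite eqEcard cards2 e2 xy andbT.
by apply/subsetP=> z; rewrite !inE => /orP[]/eqP->.
Qed.

Lemma card_cover_pairs M : {in M, forall e : {set _}, #|e| = 2} -> trivIset M ->
  #|cover M| = #|M|.*2.
Proof.
move=> M2 tM; rewrite -muln2; apply: card_uniform_partition => //.
by rewrite /partition eqxx tM; apply/negP=> /M2; rewrite cards0.
Qed.

(** The covered part of [C] is a union of disjoint pairs, so removing it preserves parity. *)
Lemma odd_card_setD_cover M C :
    {in M, forall e : {set _}, #|e| = 2} -> trivIset M ->
    {in M, forall e : {set _}, e \subset C \/ [disjoint e & C]} ->
  odd #|C :\: cover M| = odd #|C|.
Proof.
move=> M2 tM MC; have CI : C :&: cover M = cover (M ::&: C).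
  apply/setP=> x; rewrite inE; apply/andP/bigcupP=> [[xC /bigcupP[e eM xe]]|].
    exists e => //; rewrite inE eM; case: (MC e eM) => // /disjoint_setI0 eC.
    by have := in_set0 x; rewrite -eC inE xe xC.
  move=> [e]; rewrite inE => /andP[eM /subsetP eC] xe.
  by split; [exact: eC | apply/bigcupP; exists e].
rewrite -(cardsID (cover M) C) oddD CI card_cover_pairs ?odd_double //.
  by move=> e; rewrite inE => /andP[/M2].
exact: trivIsetI.
Qed.

Lemma disjoint_setUl (A B C : {set T}) :
  [disjoint A :|: B & C] = [disjoint A & C] && [disjoint B & C].
Proof. by rewrite -!setI_eq0 setIUl setU_eq0. Qed.

Lemma trivIset_setU1 M e : trivIset M -> [disjoint e & cover M] ->
  trivIset (e |: M).
Proof.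
move=> tM dis; apply: trivIsetU => //; first exact: trivIset1.
by rewrite /cover big_set1.
Qed.

Lemma notin_coverD1 M e x : trivIset M -> e \in M -> x \in e ->
  x \notin cover (M :\ e).
Proof. by move=> tM eM xe; rewrite coverD1 // !inE xe. Qed.

Lemma cover_setU1 M e : cover (e |: M) = e :|: cover M.
Proof. by rewrite /cover bigcup_setU big_set1. Qed.

End PairSets.

Section TutteBerge.
Variables (n : nat) (G : sgraph n).
Implicit Types (U : {set 'I_n}) (M : {set {set 'I_n}}) (L : 'I_n -> 'I_n).

Lemma matching_card2 M : is_matching G M ->
  {in M, forall e : {set _}, #|e| = 2}.
Proof. by move=> /andP[/subsetP sM _] e /sM /edges_card2. Qed.

Lemma leq_matching_number M : is_matching G M -> #|M| <= matching_number G.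
Proof. by move=> mM; rewrite /matching_number (bigmax_sup M). Qed.

Lemma matching_numberP :
  exists2 M, is_matching G M & #|M| = matching_number G.
Proof.
have m0 : is_matching G set0.
  by rewrite /is_matching sub0set; apply/trivIsetP => A; rewrite inE.
have [|M mM max_M] := eq_bigmax_cond (A := is_matching G) (fun M => #|M|).
  by apply/card_gt0P; exists set0.
by exists M => //; apply/esym.
Qed.

Definition avoiding U M := is_matching G M && [disjoint U & cover M].

Definition odd_classes U L :=
  #|[set c | odd #|[set v in ~: U | L v == c]|]|.

(** The easy half of the Tutte-Berge formula, for any labels constant on the components of [G - U].
    An uncovered vertex is its own [mate], so [L] composed with [mate] maps [S] onto a set
    containing every odd class, while [S] has at most [#|U| + n - 2 * #|M|] elements. *)
Lemma leq_odd_classes U L M : is_matching G M ->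
    (forall u v, u \notin U -> v \notin U -> [set u; v] \in edges G ->
       L u = L v) ->
  #|M|.*2 + odd_classes U L <= n + #|U|.
Proof.
move=> mM LE; have /andP[/subsetP sM tM] := mM; have M2 := matching_card2 mM.
pose mate y := odflt y [pick x in pblock M y :\ y].
pose S := U :|: ~: cover M.
(* An odd class contains an uncovered vertex or the mate of a vertex of [U]. *)
have sub : [set c | odd #|[set v in ~: U | L v == c]|] \subset
    [set L (mate y) | y in S].
  apply/subsetP => c; rewrite inE => odd_c; apply: contraLR odd_c => notc.
  set C := [set v in ~: U | _].
  have Cc v : v \in C -> v \notin U /\ L v = c.
    by rewrite !inE => /andP[? /eqP].
  have MC : {in M, forall e : {set _}, e \subset C \/ [disjoint e & C]}.
    move=> e eM; have [|[x]] := set_0Vmem (e :&: C).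
      by right; rewrite -setI_eq0; apply/eqP.
    rewrite inE => /andP[xe xC]; left; apply/subsetP => y ye.
    have [->//|xy] := eqVneq y x; have [xU Lx] := Cc x xC.
    have def_e : e = [set x; y].
      by apply: eq_pair (M2 e eM) _ _ _; rewrite // eq_sym.
    rewrite !inE; case: (boolP (y \in U)) => [yU|yU] /=; last first.
      by rewrite -Lx eq_sym; apply/eqP/LE; rewrite // -def_e sM.
    case/imsetP: notc; exists y; first by rewrite inE yU.
    rewrite /mate (def_pblock tM eM ye); case: pickP => [z|/(_ x)] /=.
      by rewrite def_e !inE andb_orr andNb orbF => /andP[_ /eqP->].
    by rewrite !inE xe eq_sym xy.
  rewrite -(odd_card_setD_cover M2 tM MC).
  suff -> : C :\: cover M = set0 by rewrite cards0.
  apply/setP => x; rewrite in_set0 in_setD; apply/negP => /andP[xM xC].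
  case/imsetP: notc; exists x; first by rewrite !inE xM orbT.
  have [_ <-] := Cc x xC; congr L; rewrite /mate; case: pickP => //= z.
  rewrite !inE => /andP[_]; rewrite /pblock.
  case: pickP => [e /andP[eM xe]|_] /=.
    by case/negP: xM; apply/bigcupP; exists e.
  by rewrite inE.
have le1 := leq_trans (subset_leq_card sub) (leq_imset_card _ _).
have le2 : #|S| <= #|U| + (n - #|M|.*2).
  rewrite -(card_cover_pairs M2 tM) -[n in n - _]card_ord -(cardsC (cover M))
    addKn.
  exact: leq_card_setU.
have := max_card (mem (cover M)); rewrite card_ord (card_cover_pairs M2 tM).
move: le1 le2; rewrite /odd_classes; lia.
Qed.

(** * Gallai's lemma in [G - U] *)

Section Gallai.
Variable U : {set 'I_n}.

(** The matching number of [G - U]. *)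
Definition nu := \max_(M | avoiding U M) #|M|.
Definition maximum M := avoiding U M && (#|M| == nu).

Lemma leq_nu M : avoiding U M -> #|M| <= nu.
Proof. by move=> aM; rewrite /nu (bigmax_sup M). Qed.

Lemma nuP : exists M, maximum M.
Proof.
have a0 : avoiding U set0.
  rewrite /avoiding /is_matching sub0set /cover big_set0 -setI_eq0 setI0 eqxx
    andbT.
  by apply/trivIsetP => A; rewrite inE.
have [|M aM def_nu] := eq_bigmax_cond (A := avoiding U) (fun M => #|M|).
  by apply/card_gt0P; exists set0.
exists M; apply/andP; split; first by [].
by apply/eqP/esym.
Qed.

Lemma avoiding_setU1 M e : avoiding U M -> e \in edges G -> [disjoint U & e] ->
  [disjoint e & cover M] -> avoiding U (e |: M).
Proof.
move=> /andP[/andP[sM tM] dM] eE dUe deM; apply/andP; split.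
  by rewrite /is_matching subUset sub1set eE sM trivIset_setU1.
by rewrite cover_setU1 disjoint_sym disjoint_setUl !(disjoint_sym _ U) dUe.
Qed.

Lemma avoidingS M M' : avoiding U M -> M' \subset M -> avoiding U M'.
Proof.
move=> /andP[/andP[sM tM] dM] sM'; apply/andP; split.
  by rewrite /is_matching (subset_trans sM' sM) (trivIsetS sM').
apply: disjointWr dM; apply/subsetP => x /bigcupP[e eM' xe].
by apply/bigcupP; exists e; rewrite // (subsetP sM').
Qed.

Lemma maximum_disjoint M e : maximum M -> e \in edges G -> [disjoint U & e] ->
  ~~ [disjoint e & cover M].
Proof.
move=> /andP[aM /eqP cM] eE dUe; apply/negP => deM.
have := leq_nu (avoiding_setU1 aM eE dUe deM).
rewrite cardsU1 cM; case: (boolP (e \in M)) => [eM|_]; last by rewrite ltnn.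
have /card_gt0P[x xe] : 0 < #|e| by rewrite (edges_card2 eE).
have := disjointFr deM xe; rewrite (_ : x \in cover M) //.
by apply/bigcupP; exists e.
Qed.

Definition never_both_missed u v :=
  [forall M, maximum M ==> ~~ ((u \notin cover M) && (v \notin cover M))].

(** Vertices of [U] are related only to themselves, which makes the relation reflexive on all of
    ['I_n]. *)
Definition gallai_rel u v :=
  (u == v) || [&& u \notin U, v \notin U & never_both_missed u v].

Lemma gallai_edge u v : u \notin U -> v \notin U -> [set u; v] \in edges G ->
  gallai_rel u v.
Proof.
move=> uU vU uvE; apply/orP; right; rewrite uU vU; apply/forallP => M.
apply/implyP => maxM.
apply: contra (maximum_disjoint maxM uvE _) => [/andP[uM vM]|].
  by rewrite disjoint_setUl !disjoints1 uM.
by rewrite disjoint_sym disjoint_setUl !disjoints1 uU.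
Qed.

Lemma gallai_sym u v : gallai_rel u v = gallai_rel v u.
Proof.
rewrite /gallai_rel eq_sym; congr (_ || _); rewrite andbCA; congr [&& _, _ & _].
by apply: eq_forallb => M; rewrite andbC.
Qed.

(** Suppose that a maximum matching [M] misses [u] and [v]. Among the maximum matchings missing [t],
    take [N] sharing the most edges with [M]. An exchange along an edge of [M] yields another such
    matching sharing more. *)
Lemma gallai_trans t u v :
    (forall x, x \notin U -> exists2 M, maximum M & x \notin cover M) ->
  gallai_rel u t -> gallai_rel t v -> gallai_rel u v.
Proof.
move=> missed; rewrite /gallai_rel.
have [->|ut /=] := eqVneq u t; first by [].
have [->|tv /=] := eqVneq t v; first by move=> ->; rewrite orbT.
have [//|uv /=] := eqVneq u v.
move=> /and3P[uU tU nut] /and3P[_ vU ntv]; rewrite uU vU /=.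
apply/forallP => M; apply/implyP => maxM; apply/negP => /andP[uM vM].
pose missing_t N := maximum N && (t \notin cover N).
have [N0 maxN0 tN0] := missed t tU.
have exN0 : missing_t N0 by rewrite /missing_t maxN0.
case: (@arg_maxnP _ N0 missing_t (fun N => #|M :&: N|) exN0).
move=> N /andP[maxN tN] maxMN {N0 maxN0 tN0 exN0}.
have uN : u \in cover N.
  by move: (forallP nut N); rewrite maxN tN andbT negbK.
have vN : v \in cover N.
  by move: (forallP ntv N); rewrite maxN tN negbK.
have /andP[aM /eqP cM] := maxM; have /andP[aN /eqP cN] := maxN.
have /andP[mM dUM] := aM; have /andP[mN _] := aN.
have /andP[/subsetP sM trM] := mM; have /andP[_ trN] := mN.
(* [M] and [N] cover equally many vertices, and [N] covers [u] and [v], which [M] misses. So [M]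
   covers at least two vertices missed by [N], one of them different from [t]. *)
have [x xMN xt] : exists2 x, x \in cover M :\: cover N & x != t.
  have : 1 < #|cover N :\: cover M|.
    by rewrite (cardsD1 u) (cardsD1 v) !inE uM uN vM vN eq_sym uv.
  have cc : #|cover M| = #|cover N|.
    by rewrite !card_cover_pairs ?cM ?cN //; exact: matching_card2.
  have := cardsID (cover N) (cover M); have := cardsID (cover M) (cover N).
  rewrite setIC cc => <- /addnI <-.
  rewrite (cardsD1 t) => gt1.
  have /card_gt0P[x] : 0 < #|(cover M :\: cover N) :\ t|.
    by case: (t \in _) gt1 => // /ltnW.
  by rewrite !inE => /andP[xt xMN]; exists x => //; rewrite inE.
move: xMN; rewrite inE => /andP[xN /bigcupP[e eM xe]].
have eE := sM e eM.
have dUe : [disjoint U & e].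
  by apply: disjointWr dUM; apply/subsetP=> z ze; apply/bigcupP; exists e.
have /pred0Pn[y /andP[/= ye yN]] := maximum_disjoint maxN eE dUe.
have xy : x != y by apply: contraNneq xN => ->.
have def_e := eq_pair (edges_card2 eE) xe ye xy.
have /bigcupP[f fN yf] := yN.
have eNf : e \notin N :\ f.
  by apply: contra xN; rewrite inE => /andP[_ eN]; apply/bigcupP; exists e.
have dN' : [disjoint e & cover (N :\ f)].
  rewrite def_e disjoint_setUl !disjoints1 (notin_coverD1 trN fN yf) andbT.
  by rewrite coverD1 // inE (negPf xN) andbF.
(* Replacing [f] by [e] in [N] keeps it maximum and still missing [t]. It gains the edge [e] of [M],
   and [f] is not in [M]. *)
have : #|M :&: (e |: (N :\ f))| <= #|M :&: N|.
  apply: maxMN; apply/andP; split.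
    rewrite /maximum avoiding_setU1 ?(avoidingS aN) ?subD1set //=.
    by rewrite cardsU1 eNf -cN (cardsD1 f N) fN.
  rewrite cover_setU1 coverD1 // !inE (negPf tN) andbF orbF.
  rewrite def_e !inE negb_or eq_sym xt /=.
  by apply: contraNneq tN => ->.
have fM : f \notin M.
  apply: contra xN => fM; rewrite -(def_pblock trM eM ye) in xe.
  by apply/bigcupP; exists f; rewrite // -(def_pblock trM fM yf).
rewrite leqNgt => /negP; apply; apply: proper_card; apply/properP; split.
  apply/subsetP => g; rewrite !inE => /andP[gM gN]; rewrite gM gN andbT /=.
  by rewrite (contraNneq _ fM) ?orbT // => <-.
exists e; first by rewrite !inE eM eqxx.
by rewrite inE eM /=; apply: contra xN => eN; apply/bigcupP; exists e.
Qed.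

End Gallai.

Lemma avoiding0 M : avoiding set0 M = is_matching G M.
Proof. by rewrite /avoiding -setI_eq0 set0I eqxx andbT. Qed.

Definition barrier U := (nu U + #|U| <= matching_number G) &&
  [forall (x | x \notin U), exists M, maximum U M && (x \notin cover M)].

Lemma barrier_exists : exists U, barrier U.
Proof.
(* If [U] has maximal size among the sets with [nu U + #|U| <= nu set0],
   then adding a vertex to [U] cannot decrease [nu]. *)
have nu0 : nu set0 + #|set0 : {set 'I_n}| <= matching_number G.
  rewrite cards0 addn0; apply/bigmax_leqP => M; rewrite avoiding0.
  exact: leq_matching_number.
case: (@arg_maxnP _ set0 (fun U => nu U + #|U| <= matching_number G)
         (fun U => #|U|) nu0) => U leU maxU.
exists U; rewrite /barrier leU; apply/forall_inP => x xU.
have [M /andP[aM /eqP cM]] := nuP (x |: U).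
have le_nu : nu U <= nu (x |: U).
  rewrite leqNgt; apply/negP => lt_nu; have := maxU (x |: U).
  rewrite cardsU1 xU /= add1n ltnn => /(_ _)/negP; apply=> //.
  by rewrite addnS (leq_trans _ leU) // ltn_add2r.
move: aM; rewrite /avoiding disjoint_setUl disjoints1 => /and3P[mM xM dM].
have aM : avoiding U M by rewrite /avoiding mM.
by apply/existsP; exists M; rewrite xM andbT /maximum aM eqn_leq leq_nu // cM.
Qed.

(** The hard half of the formula. By the second hypothesis on [L], every Gallai class is a union of
    label classes. Let [M] be a maximum matching of [G - U]. A Gallai class with a vertex missed by
    [M] is odd, because [M] pairs its other vertices inside the class; so it contains an odd label
    class. There are [n - #|U| - 2 * nu U] missed vertices, and [nu U + #|U|] is at most the
    matching number. *)
Lemma leq_barrier U L : barrier U ->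
    (forall R : rel 'I_n, reflexive R -> symmetric R -> transitive R ->
       (forall u v, u \notin U -> v \notin U -> [set u; v] \in edges G ->
          R u v) ->
     forall u v, L u = L v -> R u v) ->
  n + #|U| <= (matching_number G).*2 + odd_classes U L.
Proof.
move=> /andP[leU /forall_inP missedb] finest.
have missed x : x \notin U -> exists2 M, maximum U M & x \notin cover M.
  by move=> /missedb/existsP[M /andP[maxM xM]]; exists M.
pose R := gallai_rel U.
have R_refl : reflexive R by move=> x; rewrite /R /gallai_rel eqxx.
have R_sym : symmetric R by move=> x y; exact: gallai_sym.
have R_trans : transitive R by move=> t u v; apply: gallai_trans missed.
have LR u v : L u = L v -> R u v.
  by apply: finest => // {}u {}v; apply: gallai_edge.
have [M maxM] := nuP U; have /andP[/andP[mM dM] /eqP cM] := maxM.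
have /andP[/subsetP sM tM] := mM; have M2 := matching_card2 mM.
pose D := ~: U :\: cover M.
have DU d : d \in D -> d \notin U /\ d \notin cover M.
  by rewrite !inE => /andP[].
pose C d := [set v in ~: U | R d v].
have odd_C d : d \in D -> odd #|C d|.
  move=> dD; have [dU dMc] := DU d dD.
  have <- : odd #|C d :\: cover M| = odd #|C d|.
    apply: odd_card_setD_cover => // e eM.
    have [|[x]] := set_0Vmem (e :&: C d).
      by right; rewrite -setI_eq0; apply/eqP.
    rewrite !inE => /and3P[xe xU Rdx]; left; apply/subsetP => y ye.
    have [->|xy] := eqVneq y x; first by rewrite !inE xU.
    have yU : y \notin U.
      by rewrite (disjointFl dM) //; apply/bigcupP; exists e.
    rewrite !inE yU (R_trans _ _ _ Rdx) //; apply: gallai_edge => //.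
    by rewrite -(eq_pair (M2 e eM) xe ye) ?sM // eq_sym.
  suff -> : C d :\: cover M = [set d] by rewrite cards1.
  apply/setP=> v; rewrite !inE; apply/and3P/eqP => [[vM vU /orP[/eqP//|]]|->].
    by move=> /and3P[_ _ /forallP/(_ M)]; rewrite maxM dMc vM.
  by rewrite dMc dU R_refl.
(* The odd class [C d] is partitioned by labels, so some part is odd; [g d] is its label. *)
have [g gP] : exists g : 'I_n -> 'I_n, forall d, d \in D ->
    odd #|[set v in ~: U | L v == g d]| /\
    exists2 v, v \in C d & L v = g d.
  apply: (fin_all_exists (P := fun d c => d \in D ->
    odd #|[set v in ~: U | L v == c]| /\ exists2 v, v \in C d & L v = c)) => d.
  case: (boolP (d \in D)) => [dD|]; last by exists d.
  have card_C : #|C d| = \sum_(c : 'I_n) #|[set v in C d | L v == c]|.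
    rewrite -sum1_card (partition_big L predT) //; apply: eq_bigr => c _.
    by rewrite -sum1_card; apply: eq_bigl => v; rewrite !inE.
  have [c odd_c] : exists c, odd #|[set v in C d | L v == c]|.
    apply/existsP; apply: contraTT (odd_C d dD); rewrite negb_exists card_C.
    move=> /forallP even_c.
    rewrite (big_morph odd oddD (erefl : odd 0 = false)).
    by rewrite big1 // => c _; apply/negbTE.
  have [v] : exists v, v \in [set v in C d | L v == c].
    by apply/set0Pn; apply: contraTneq odd_c => ->; rewrite cards0.
  rewrite !inE -andbA => /and3P[vU Rdv /eqP Lv].
  exists c => _; split; last by exists v; rewrite // !inE vU.
  rewrite (_ : [set v in ~: U | _] = [set v in C d | L v == c]) //.
  apply/setP=> x; rewrite !inE -andbA; congr (_ && _).
  case: (L x =P c) => [Lx|]; rewrite ?andbF // andbT.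
  by rewrite (R_trans _ _ _ Rdv) // LR // Lv Lx.
(* The vertices missed by [M] lie in pairwise distinct Gallai classes. *)
have leD : #|D| <= odd_classes U L.
  have <- : #|g @: D| = #|D|.
    apply: card_in_imset => d d' dD d'D eq_g.
    have [_ [v]] := gP d dD; have [_ [v']] := gP d' d'D.
    rewrite !inE -eq_g => /andP[_ Rdv'] Lv' /andP[_ Rdv] Lv.
    have : R d d'.
      apply: (R_trans _ _ _ Rdv); apply: (R_trans v'); last by rewrite R_sym.
      by apply: LR; rewrite Lv.
    case/orP=> [/eqP//|/and3P[_ _ /forallP/(_ M)]].
    by have [[_ ->] [_ ->]] := (DU d dD, DU d' d'D); rewrite maxM.
  apply: subset_leq_card; apply/subsetP => c /imsetP[d dD ->].
  by rewrite inE; case: (gP d dD).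
have := cardsID (cover M) (~: U); rewrite -/D.
have -> : ~: U :&: cover M = cover M.
  by apply/setIidPr; rewrite -disjoints_subset disjoint_sym.
rewrite (card_cover_pairs M2 tM) cM.
have := cardsC U; rewrite card_ord.
move: leD leU; lia.
Qed.

End TutteBerge.

(** * Colorings in which only the matching edges are monochromatic *)

Lemma greedy_coloring (X K : finType) (k0 : K) (r : rel X) : symmetric r ->
    irreflexive r -> (forall x, #|[set y | r x y]| < #|K|) ->
  exists c : X -> K, forall x y, r x y -> c x != c y.
Proof.
move=> r_sym r_irr deg.
suff /(_ (enum X))[c cP] : forall s : seq X, exists c : X -> K,
    {in s &, forall x y, r x y -> c x != c y}.
  by exists c => x y; apply: cP; rewrite mem_enum.
elim=> [|x s [c cP]]; first by exists (fun=> k0).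
have [xs|xs] := boolP (x \in s).
  by exists c => y z; rewrite !inE => /predU1P[->|ys] /predU1P[->|zs];
    apply: cP.
(* The new color avoids the values of [c] on all neighbors of [x], including those outside [s];
   there are still fewer of them than colors. *)
have /subsetPn[k _ kP] : ~~ ([set: K] \subset [set c y | y in [set y | r x y]]).
  apply/negP => /subset_leq_card; rewrite cardsT leqNgt => /negP; apply.
  exact: leq_ltn_trans (leq_imset_card _ _) (deg x).
have kc y : r x y -> k != c y.
  by move=> rxy; apply: contraNneq kP => ->; apply/imset_f; rewrite inE.
exists (fun y => if y == x then k else c y) => y z; rewrite !inE.
case: eqP => [->|_] /= => [_|ys]; case: eqP => [->|_] /= => [_|zs].
- by rewrite r_irr.
- exact: kc.
- by rewrite r_sym eq_sym; apply: kc.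
- exact: cP.
Qed.

Lemma matching_coloring n (G : sgraph n) (M : {set {set 'I_n}}) (K : finType) :
    is_matching G M -> (max_degree G).*2 < #|K| ->
  exists col : 'I_n -> K, forall u v, [set u; v] \in edges G ->
    (col u == col v) = ([set u; v] \in M).
Proof.
move=> mM ltK; have /andP[/subsetP sM tM] := mM; have M2 := matching_card2 mM.
have /card_gt0P[k0 _] : 0 < #|K| by apply: leq_ltn_trans ltK.
pose cl v := if v \in cover M then pblock M v else [set v].
have mem_cl v : v \in cl v.
  by rewrite /cl; case: ifP => [|_]; rewrite ?mem_pblock ?set11.
have eq_cl u v : u \in cl v -> cl u = cl v.
  rewrite /cl; case: (boolP (v \in cover M)) => [vM uv|vM]; last first.
    by rewrite inE => /eqP->; rewrite (negPf vM).
  rewrite (same_pblock tM uv) (_ : u \in _) //.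
  by apply/bigcupP; exists (pblock M v); first exact: pblock_mem.
pose r A B := (A != B) && [exists u, exists v,
  [&& cl u == A, cl v == B & [set u; v] \in edges G]].
have r_sym : symmetric r.
  have half A B : r A B -> r B A.
    case/andP=> AB /existsP[u /existsP[v /and3P[uA vB uvE]]].
    rewrite /r eq_sym AB; apply/existsP; exists v; apply/existsP; exists u.
    by rewrite vB uA setUC.
  by move=> A B; apply/idP/idP; apply: half.
have r_irr : irreflexive r by move=> A; rewrite /r eqxx.
have deg A : #|[set B | r A B]| < #|K|.
  apply: leq_ltn_trans ltK.
  (* [f] sends an edge leaving the class [A] to the class of its outer end, so the neighbors of [A]
     are images of edges meeting [A]. *)
  pose f e := if [pick x in e :\: A] is Some x then cl x else set0.
  pose EA := \bigcup_(x in A) [set e in edges G | x \in e].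
  (* The contracted graph lives on all sets of vertices. A set that is no class is isolated; a class
     has at most two elements, whence the factor 2. *)
  have [->|[B]] := set_0Vmem [set B | r A B]; first by rewrite cards0.
  rewrite inE => /andP[_ /existsP[u0 /existsP[_ /andP[/eqP def_A _]]]] {B}.
  have A2 : #|A| <= 2.
    rewrite -def_A /cl; case: ifP => [/pblock_mem/M2->//|_].
    by rewrite cards1.
  have sub : [set B | r A B] \subset f @: EA.
    apply/subsetP => B; rewrite inE.
    move=> /andP[AB /existsP[u /existsP[v /and3P[/eqP uA /eqP vB uvE]]]].
    have uinA : u \in A by rewrite -uA.
    have vA : v \notin A.
      by apply: contra AB; rewrite -uA -vB => /eq_cl ->.
    apply/imsetP; exists [set u; v].
      by apply/bigcupP; exists u; rewrite // !inE uvE eqxx.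
    rewrite /f; case: pickP => [x|/(_ v)]; last by rewrite !inE vA eqxx orbT.
    rewrite !inE => /andP[xA /orP[]/eqP def_x]; last by rewrite def_x vB.
    by rewrite def_x uinA in xA.
  apply: leq_trans (subset_leq_card sub) (leq_trans (leq_imset_card _ _) _).
  apply: (@leq_trans (\sum_(x in A) max_degree G)); last first.
    by rewrite sum_nat_const -mul2n leq_mul2r A2 orbT.
  apply: (@leq_trans (\sum_(x in A) #|[set e in edges G | x \in e]|)).
    rewrite /EA; elim/big_rec2: _ => [|x m P _ le_m]; first by rewrite cards0.
    by apply: leq_trans (leq_card_setU _ _) _; rewrite leq_add2l.
  apply: leq_sum => x _; exact: (leq_bigmax x).
have [c cP] := greedy_coloring k0 r_sym r_irr deg.
exists (fun v => c (cl v)) => u v uvE.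
have uv : u != v by have := edges_card2 uvE; rewrite cards2; case: eqP.
apply/idP/idP => [|uvM]; last first.
  rewrite (eq_cl u v) // /cl.
  have vM : v \in cover M by apply/bigcupP; exists [set u; v]; rewrite ?set22.
  by rewrite vM (def_pblock tM uvM) ?set21 ?set22.
apply: contraLR => uvM; apply: cP; rewrite /r; apply/andP; split; last first.
  by apply/existsP; exists u; apply/existsP; exists v; rewrite !eqxx.
apply: contra uvM => /eqP def_cl; have := mem_cl u; rewrite def_cl /cl.
case: ifP => [vM|_]; last by rewrite inE (negPf uv).
move=> uP; have PM := pblock_mem vM.
rewrite -(eq_pair (M2 _ PM) uP) // mem_pblock //.
Qed.

(** * Streams and thresholds *)

Section Streams.
Variables (n : nat) (G : sgraph n) (es : seq ('I_n * 'I_n)).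
Hypothesis Ges : edge_stream G es.

Definition ends (p : 'I_n * 'I_n) : {set 'I_n} := [set p.1; p.2].

Lemma stream_count (Q : pred {set 'I_n}) :
  count (Q \o ends) es = #|[set e in edges G | Q e]|.
Proof.
rewrite -count_map (permP Ges) -size_filter cardE.
apply/perm_size/uniq_perm => [||e];
  [exact/filter_uniq/enum_uniq|exact: enum_uniq|].
by rewrite mem_filter !mem_enum inE andbC.
Qed.

Lemma mem_stream e : (e \in map ends es) = (e \in edges G).
Proof. by rewrite (perm_mem Ges) mem_enum. Qed.

Lemma uniq_stream : uniq (map ends es).
Proof. by rewrite (perm_uniq Ges) enum_uniq. Qed.

End Streams.

Lemma double_matching n (G : sgraph n) M : is_matching G M -> #|M|.*2 <= n.
Proof.
move=> mM; rewrite -(card_cover_pairs (matching_card2 mM)) ?(andP mM).2 //.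
by rewrite -[leqRHS]card_ord max_card.
Qed.

Lemma double_matching_number n (G : sgraph n) : (matching_number G).*2 <= n.
Proof. by have [M mM <-] := matching_numberP G; apply: double_matching mM. Qed.

(* Thresholds above [n] are as good as [n.+1], negative ones as good as 0. *)
Definition clip n (k : int) : 'I_n.+2 :=
  inord (if k is Posz m then minn m n.+1 else 0).

Lemma clip_leq n k x : x <= n -> (clip n k <= x) = (k <= x%:Z)%R.
Proof.
move=> le_xn; rewrite /clip inordK; case: k => [m|m] //.
  by rewrite lez_nat; lia.
by rewrite ltnS geq_minr.
Qed.

(** * Listing the edges of a matching *)

Lemma foldl_map (R S T : Type) (f : R -> T -> R) (g : S -> T) z s :
  foldl f z (map g s) = foldl (fun a x => f a (g x)) z s.
Proof. by elim: s z => /=. Qed.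

Section EdgeList.
Variable n : nat.

Let w := (up_log 2 #|{: 'I_n * 'I_n}|).+1.

(* The leading [true] distinguishes listed edges from the padding. *)
Definition edge_word (p : 'I_n * 'I_n) : w.-tuple bool :=
  [tuple of true :: encode p].

Definition listed (wd : w.-tuple bool) : option {set 'I_n} :=
  omap (@ends n) [pick p | edge_word p == wd].

Lemma listed_edge_word p : listed (edge_word p) = Some (ends p).
Proof.
rewrite /listed.
case: pickP => [q /eqP /(congr1 val) [/val_inj/encode_inj->]|] //.
by move/(_ p); rewrite eqxx.
Qed.

Lemma listed_default : listed [tuple false | j < w] = None.
Proof.
rewrite /listed; case: pickP => //= p /eqP/(congr1 (fun x => tnth x ord0)).
by rewrite tnth_mktuple.
Qed.

Definition meets (e : {set 'I_n}) (o : option {set 'I_n}) :=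
  if o is Some x then ~~ [disjoint x & e] else false.

(* [Some true] once exactly one listed edge meeting [e] has been seen, and
   this edge is [e]. *)
Definition update e (a : option bool) o :=
  if meets e o then Some ((a == None) && (o == Some e)) else a.

Lemma foldl_update e s :
  (foldl (update e) None s == Some true) = (filter (meets e) s == [:: Some e]).
Proof.
have stuck r : foldl (update e) (Some false) r = Some false.
  by elim: r => //= o r IHr; rewrite {2}/update; case: ifP.
have once r : (foldl (update e) (Some true) r == Some true) =
    (filter (meets e) r == [::]).
  by elim: r => //= o r IHr; rewrite {2}/update; case: ifP; rewrite ?stuck.
elim: s => //= o s IHs; rewrite {2}/update; case: ifP => // _.
rewrite eqseq_cons; case: (o == Some e) => /=; first exact: once.
by rewrite stuck.
Qed.

(** The state is the number of edges still to be counted, truncated at 0. All [n] words are scanned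
    whatever the threshold, since padding words decode to [None]. *)
Definition edge_list_scanner : scanner n := {|
  state := 'I_n.+2;
  acc := option bool;
  width := up_log 2 #|{: 'I_n * 'I_n}|;
  nwords := n;
  init := clip n;
  acc0 := None;
  upd := fun _ oe a _ wd =>
    if oe is Some e then update (ends e) a (listed wd) else a;
  step := fun t _ a => if a == Some true then inord t.-1 else t;
  out := fun t _ => t == 0 :> nat |}.

Definition listing c := [seq listed (word w c i) | i <- iota 0 n].
Definition good c e := filter (meets e) (listing c) == [:: Some e].

Lemma edge_list_result k c es :
  result edge_list_scanner k c es = (clip n k <= count (good c \o @ends n) es).
Proof.
rewrite /result /= -subn_eq0; congr (_ == 0).
elim: es (clip n k) => [|e es IHes] t /=; first by rewrite subn0.
rewrite {}IHes /scan /= -(foldl_map _ (fun i => listed (word w c i))).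
rewrite foldl_update -/(good c (ends e)); case: (good _ _) => //=.
by rewrite inordK ?(leq_ltn_trans (leq_pred _)) // -subn1 subnDA.
Qed.

(** A good edge is itself listed. If it meets another good edge [e], it is a listed edge meeting
    [e], hence equal to [e]. *)
Lemma good_matching (G : sgraph n) c :
  is_matching G [set e in edges G | good c e].
Proof.
apply/andP; split; first by apply/subsetP => e; rewrite inE => /andP[].
apply/trivIsetP => e e'; rewrite !inE => /andP[_ /eqP ge] /andP[_ /eqP ge'].
apply: contraNT => nd; have : Some e' \in [:: Some e].
  rewrite -ge mem_filter /= disjoint_sym nd /=.
  by have : Some e' \in [:: Some e'] := mem_head _ _;
    rewrite -{1}ge' mem_filter => /andP[].
by rewrite inE eq_sym.
Qed.

Definition max_matching (G : sgraph n) :=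
  odflt set0 [pick M | is_matching G M & #|M| == matching_number G].

Lemma max_matchingP (G : sgraph n) :
  is_matching G (max_matching G) /\ #|max_matching G| = matching_number G.
Proof.
rewrite /max_matching; case: pickP => [M /andP[mM /eqP]//|no].
by have [M mM cM] := matching_numberP G; have := no M; rewrite mM cM eqxx.
Qed.

(** The list is cut after [k] edges of a maximum matching, because the size bound is linear in
    [k]. *)
Definition edge_list_prover (G : sgraph n) (k : int) : seq bool :=
  let lst := enum (max_matching G) in
  let f i := if [pick p | ends p == nth set0 lst i] is Some p then edge_word p
             else [tuple false | j < w] in
  if k is Posz m then of_words m f else [::].

Lemma listing_prover (G : sgraph n) m : m <= matching_number G ->
  listing (edge_list_prover G m) =
  map Some (take m (enum (max_matching G))) ++ nseq (n - m) None.
Proof.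
have [mM cM] := max_matchingP G; have M2 := matching_card2 mM.
move=> le_m; have le_mn : m <= n.
  by have := double_matching_number G; lia.
have sz : size (take m (enum (max_matching G))) = m.
  by rewrite size_takel // -cardE cM.
apply: (@eq_from_nth _ None).
  by rewrite size_map size_iota size_cat size_map size_nseq sz subnKC.
move=> i; rewrite size_map size_iota => lt_in.
rewrite (nth_map 0) ?size_iota // nth_iota // add0n nth_cat size_map sz.
rewrite word_of_words.
case: ltnP => [lt_im|le_mi]; last first.
  by rewrite listed_default nth_nseq; case: ifP.
rewrite (nth_map set0) ?sz // nth_take //.
set e := nth _ _ _; case: pickP => [p /eqP <-|]; first exact: listed_edge_word.
have /M2/eqP/cards2P[x [y [_ def_e]]] : e \in max_matching G.
  by rewrite -mem_enum mem_nth // -cardE cM (leq_trans lt_im).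
by move/(_ (x, y)); rewrite /ends /= -def_e eqxx.
Qed.

Lemma good_prover (G : sgraph n) m e : m <= matching_number G ->
  e \in take m (enum (max_matching G)) -> good (edge_list_prover G m) e.
Proof.
move=> le_m; set s := take _ _ => es; rewrite /good listing_prover // -/s.
have [/andP[_ /trivIsetP tM] _] := max_matchingP G.
have sM x : x \in s -> x \in max_matching G by move/mem_take; rewrite mem_enum.
have e0 : e != set0.
  by apply/eqP => e0; have := matching_card2 (max_matchingP G).1 (sM _ es);
    rewrite e0 cards0.
rewrite filter_cat (_ : filter _ (nseq _ _) = [::]) ?cats0; last first.
  by elim: (n - m).
rewrite filter_map (_ : filter _ s = [:: e]) //.
rewrite -(filter_pred1_uniq (take_uniq m (enum_uniq (max_matching G))) es).
apply: eq_in_filter => x xs /=; have [->|xe] := eqVneq x e.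
  by rewrite -setI_eq0 setIid e0.
by rewrite tM ?sM.
Qed.

Lemma edge_list_complete (G : sgraph n) k : MaxMatching_ge G k ->
  forall es, edge_stream G es ->
    result edge_list_scanner k (edge_list_prover G k) es.
Proof.
rewrite /MaxMatching_ge => le_k es Ges; rewrite edge_list_result.
rewrite (stream_count Ges) clip_leq; last first.
  by have := double_matching (good_matching G (edge_list_prover G k)); lia.
case: k le_k => // m; rewrite !lez_nat => le_m.
have [mM cM] := max_matchingP G; set s := take m (enum (max_matching G)).
have sz : size s = m by rewrite size_takel // -cardE cM.
rewrite -{1}sz cardE uniq_leq_size ?take_uniq ?enum_uniq // => e es'.
rewrite mem_enum inE good_prover // andbT.
by have /andP[/subsetP sM _] := mM; rewrite sM // -mem_enum (mem_take es').
Qed.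

Lemma edge_list_sound (G : sgraph n) k c es : edge_stream G es ->
  result edge_list_scanner k c es -> MaxMatching_ge G k.
Proof.
move=> Ges; rewrite edge_list_result (stream_count Ges) clip_leq; last first.
  by have := double_matching (good_matching G c); lia.
by move=> /Order.POrderTheory.le_trans; apply;
  rewrite lez_nat leq_matching_number ?good_matching.
Qed.

End EdgeList.

(** * Coloring the vertices *)

Lemma foldl_andb (T : Type) (Q : pred T) b s :
  foldl (fun a x => a && Q x) b s = b && all Q s.
Proof. by elim: s b => [|x s IHs] b /=; rewrite ?andbT // IHs andbA. Qed.

Section Coloring.
Variable n : nat.
Implicit Types (p : 'I_n * 'I_n) (es : seq ('I_n * 'I_n)) (c : seq bool).

(* Word [i] of the certificate holds bit [i] of the color of every vertex. *)
Definition coloring_scanner : scanner n := {|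
  state := ({set 'I_n} * bool * 'I_n.+2)%type;
  acc := bool;
  width := n;
  nwords := n.+2;
  init := fun k => (set0, true, clip n k);
  acc0 := true;
  upd := fun _ oe a _ wd =>
    if oe is Some e then a && (nth false wd e.1 == nth false wd e.2) else a;
  step := fun t e a => let: (used, ok, k) := t in
    if a then (ends e :|: used, ok && [disjoint ends e & used], k) else t;
  out := fun t _ => let: (used, ok, k) := t in ok && (k.*2 <= #|used|) |}.

Definition same_color c p :=
  all (fun i => nth false (word n.+1 c i) p.1 == nth false (word n.+1 c i) p.2)
      (iota 0 n.+2).

Lemma scan_coloring c t p :
  @scan _ coloring_scanner c t (Some p) = same_color c p.
Proof. exact: (foldl_andb _ true). Qed.

Lemma coloring_stream_rcons c t es p :
  @stream_state _ coloring_scanner c t (rcons es p) =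
  @step _ coloring_scanner (stream_state c t es) p (same_color c p).
Proof. by rewrite /stream_state foldl_rcons scan_coloring. Qed.

(** Each monochromatic edge is checked against the marked vertices before it is added, so
    disjointness does not rely on an honest certificate. *)
Lemma coloring_stream_sound c es k :
  let: (used, ok, k') :=
    @stream_state _ coloring_scanner c (set0, true, k) es in
  k' = k /\ (ok -> exists M : {set {set 'I_n}},
    [/\ {subset M <= map (@ends n) es}, trivIset M & cover M = used]).
Proof.
elim/last_ind: es => [|es p].
  split=> // _; exists set0; split; rewrite ?/cover ?big_set0 //.
    by move=> e; rewrite inE.
  by apply/trivIsetP => A; rewrite inE.
rewrite coloring_stream_rcons /=.
case: (stream_state _ _ _) => [[used ok] k'] [-> IH].
case: (same_color c p); split=> //.
  move=> /andP[/IH[M [sM tM <-]] dp]; exists (ends p |: M).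
  split; rewrite ?trivIset_setU1 ?cover_setU1 // => e.
  by rewrite !inE map_rcons mem_rcons inE => /predU1P[->|/sM->];
    rewrite ?eqxx ?orbT.
move=> /IH[M [sM tM <-]]; exists M; split=> // e /sM.
by rewrite map_rcons mem_rcons inE orbC => ->.
Qed.

Lemma coloring_stream_complete c es k (M : {set {set 'I_n}}) : trivIset M ->
    uniq (map (@ends n) es) ->
    {in es, forall p, same_color c p = (ends p \in M)} ->
  @stream_state _ coloring_scanner c (set0, true, k) es =
  (cover [set e in M | e \in map (@ends n) es], true, k).
Proof.
move=> tM; elim/last_ind: es => [|es p IHes].
  rewrite (_ : [set e in M | _] = set0) ?/cover ?big_set0 //.
  by apply/setP => e; rewrite !inE andbF.
rewrite map_rcons rcons_uniq => /andP[p_new /IHes{}IHes] sel.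
rewrite coloring_stream_rcons sel ?mem_rcons ?mem_head //.
rewrite {}IHes /=; last by move=> q qes; rewrite sel // mem_rcons inE qes orbT.
case: ifP => pM; last first.
  congr (cover _, _, _); apply/setP => e; rewrite !inE mem_rcons inE.
  by case: eqP => // ->; rewrite pM.
congr (_, _, _).
  rewrite -cover_setU1; congr cover; apply/setP => e;
    rewrite !inE mem_rcons inE.
  by case: eqP => // ->; rewrite pM.
(* A shared vertex would make the new edge equal to an earlier edge of [M], but no edge arrives
   twice. *)
rewrite -setI_eq0; apply/eqP/setP => x; rewrite in_set0;
  apply/negP => /setIP[xp].
case/bigcupP => e; rewrite inE => /andP[eM ees] xe.
case/negP: p_new; rewrite -(def_pblock tM pM xp) (def_pblock tM eM xe) //.
Qed.

Lemma coloring_sound (G : sgraph n) k c es : edge_stream G es ->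
  result coloring_scanner k c es -> MaxMatching_ge G k.
Proof.
move=> Ges; rewrite /result /=; have := coloring_stream_sound c es (clip n k).
case: (stream_state _ _ _) =>
  [[used ok] k'] [-> okM] /andP[/okM[M [sM tM <-]] le_k].
have mM : is_matching G M.
  by rewrite /is_matching tM andbT; apply/subsetP => e /sM;
    rewrite (mem_stream Ges).
move: le_k; rewrite (card_cover_pairs (matching_card2 mM) tM) leq_double
  clip_leq.
  by move=> /Order.POrderTheory.le_trans; apply;
    rewrite lez_nat leq_matching_number.
by have := double_matching mM; lia.
Qed.

(* When [max_degree G <= 1], the edges form a matching and one color is enough;
   this matters as [log2 1 = 0]. *)
Definition color_bits (G : sgraph n) :=
  if max_degree G <= 1 then 0 else (log2 (max_degree G)).+2.

(** Matching and coloring form one pair with a boolean test, so that [xchoose] can select both for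
    the prover. *)
Definition separating (G : sgraph n)
    (x : {set {set 'I_n}} * {ffun 'I_n -> (color_bits G).-tuple bool}) :=
  [&& is_matching G x.1, #|x.1| == matching_number G &
   [forall u, forall v, ([set u; v] \in edges G) ==>
     ((x.2 u == x.2 v) == ([set u; v] \in x.1))]].

Lemma separating_exists (G : sgraph n) : exists x, @separating G x.
Proof.
case: (leqP (max_degree G) 1) => deg; last first.
  have [M mM cM] := matching_numberP G.
  (* [(log2 Delta).+1] bits give more than [Delta] colors, and one further bit provides the factor
     2. *)
  have ltK : (max_degree G).*2 < #|{: (color_bits G).-tuple bool}|.
    rewrite card_tuple card_bool /color_bits (leqNgt _ 1) deg /= expnS mul2n
      ltn_double.
    exact: trunc_log_ltn.
  have [col colP] := matching_coloring mM ltK.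
  exists (M, [ffun v => col v]); rewrite /separating mM cM eqxx /=.
  apply/forallP => u; apply/forallP => v; apply/implyP => uvE.
  by rewrite !ffunE colP.
have mE : is_matching G (edges G).
  rewrite /is_matching subxx; apply/trivIsetP => e f eE fE; apply: contraNT.
  rewrite -setI_eq0 => /set0Pn[x /setIP[xe xf]].
  have le1 : #|[set e in edges G | x \in e]| <= 1.
    exact: leq_trans (leq_bigmax x) deg.
  apply/eqP; apply: (card_le1_eqP le1); by rewrite inE ?eE ?fE.
exists (edges G, [ffun=> [tuple false | j < _]]); rewrite /separating mE /=.
rewrite eqn_leq leq_matching_number //=; apply/andP; split.
  have [M /andP[sM _] <-] := matching_numberP G; exact: subset_leq_card.
apply/forallP => u; apply/forallP => v; apply/implyP => uvE.
by rewrite !ffunE eqxx uvE.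
Qed.

(** A scanner word has [n.+1] bits; its last position belongs to no vertex and is set to [false]. *)
Definition coloring_prover (G : sgraph n) (k : int) : seq bool :=
  let col := (xchoose (separating_exists G)).2 in
  let plane i :=
    [tuple if insub (val v) is Some u then nth false (col u) i else false
    | v < n.+1] in
  of_words (color_bits G) plane.

(** This ensures that the [n.+2] words scanned contain every bit of the colors. The edges at a
    vertex are subsets of ['I_n], so the crude bound [2 ^ n] on the degree suffices. *)
Lemma leq_color_bits (G : sgraph n) : color_bits G <= n.+2.
Proof.
rewrite /color_bits; case: ifP => // _; rewrite !ltnS.
have : max_degree G <= 2 ^ n.
  apply/bigmax_leqP => v _; apply: leq_trans (max_card _) _.
  by rewrite -cardsT -powersetT card_powerset cardsT card_ord.
by move=> /(leq_trunc_log 2); rewrite trunc_expnK.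
Qed.

Lemma same_color_prover (G : sgraph n) k p :
  same_color (coloring_prover G k) p =
  let col := (xchoose (separating_exists G)).2 in col p.1 == col p.2.
Proof.
rewrite /=; set col := (xchoose _).2.
have bit i (v : 'I_n) :
    nth false (word n.+1 (coloring_prover G k) i) v = nth false (col v) i.
  have lt_v : v < n.+1 by rewrite ltnS ltnW.
  rewrite -[v : nat]/(val (Ordinal lt_v)).
  rewrite word_of_words; case: ltnP => [lt_i|le_i];
    rewrite -tnth_nth tnth_mktuple.
    by rewrite /= (valK v).
  by rewrite nth_default ?size_tuple.
rewrite /same_color; apply/allP/eqP => [eq_bits|eq_col i _]; last first.
  by rewrite !bit eq_col.
apply/val_inj/(@eq_from_nth _ false); rewrite ?size_tuple // => i lt_i.
apply/eqP; rewrite -!bit; apply: eq_bits.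
by rewrite mem_iota (leq_trans lt_i) // leq_color_bits.
Qed.

Lemma coloring_complete (G : sgraph n) k : MaxMatching_ge G k ->
  forall es, edge_stream G es ->
    result coloring_scanner k (coloring_prover G k) es.
Proof.
rewrite /MaxMatching_ge => le_k es Ges; rewrite /result /=.
set x := xchoose (separating_exists G).
have /and3P[mM /eqP cM /forallP col] : separating x := xchooseP _.
have /andP[/subsetP sM tM] := mM.
rewrite (coloring_stream_complete _ tM (uniq_stream Ges)); last first.
  move=> p pes; rewrite same_color_prover /= -/x.
  have pE : ends p \in edges G by rewrite -(mem_stream Ges) map_f.
  exact: eqP (implyP (forallP (col p.1) p.2) pE).
rewrite (_ : [set e in x.1 | _] = x.1); last first.
  by apply/setP => e; rewrite !inE (mem_stream Ges);
    case: (boolP (e \in x.1)) => //= /sM.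
rewrite (card_cover_pairs (matching_card2 mM) tM) leq_double cM clip_leq //.
by have := double_matching_number G; lia.
Qed.

End Coloring.

(** * Barriers *)

Section Barrier.
Variable n : nat.
Implicit Types (p : 'I_n * 'I_n) (es : seq ('I_n * 'I_n)) (c : seq bool).

Definition set_of_word (wd : n.+1.-tuple bool) : {set 'I_n} :=
  [set v : 'I_n | nth false wd v].

(* The labels [L] describe the connected components, outside [U], of the graph
   formed by the edges read so far. *)
Definition barrier_scanner : scanner n := {|
  state := ({ffun 'I_n -> 'I_n} * option 'I_n.+1)%type;
  acc := n.+1.-tuple bool;
  width := n;
  nwords := 1;
  init := fun k => ([ffun v => v],
    if k is Posz m then Some (inord (minn m n)) else None);
  acc0 := [tuple false | j < n.+1];
  upd := fun _ _ _ _ wd => wd;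
  step := fun t p wd => let: (L, k) := t in let U := set_of_word wd in
    if (p.1 \notin U) && (p.2 \notin U) then
      ([ffun v => if L v == L p.1 then L p.2 else L v], k) else t;
  out := fun t wd => let: (L, k) := t in let U := set_of_word wd in
    if k is Some k' then n + #|U| <= k'.*2 + odd_classes U L else false |}.

Lemma barrier_resultE k c es : result barrier_scanner k c es =
  @out _ barrier_scanner
    (stream_state c (init barrier_scanner k) es) (word n.+1 c 0).
Proof. by []. Qed.

Lemma barrier_stream_rcons c t es p :
  @stream_state _ barrier_scanner c t (rcons es p) =
  @step _ barrier_scanner (stream_state c t es) p (word n.+1 c 0).
Proof. by rewrite /stream_state foldl_rcons. Qed.

(** The last two properties describe connected components without paths: soundness uses that labels
    agree along edges outside [U], completeness that label equality lies in every equivalence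
    relation containing these edges. *)
Lemma barrier_streamP c es k : let U := set_of_word (word n.+1 c 0) in
  let: (L, k') := @stream_state _ barrier_scanner c ([ffun v => v], k) es in
  [/\ k' = k,
      {in es, forall p, p.1 \notin U -> p.2 \notin U -> L p.1 = L p.2} &
      forall R : rel 'I_n, reflexive R -> symmetric R -> transitive R ->
        {in es, forall p, p.1 \notin U -> p.2 \notin U -> R p.1 p.2} ->
      forall u v, L u = L v -> R u v].
Proof.
move=> U; elim/last_ind: es => [|es p].
  by split=> // R R_refl _ _ _ u v; rewrite !ffunE => ->.
rewrite barrier_stream_rcons /=;
  case: (stream_state _ _ _) => [L k'] [-> LE LR].
rewrite -/U; case: ifP => [/andP[p1U p2U]|pU]; last first.
  split=> // [q|R R_refl R_sym R_trans RE].
    by rewrite mem_rcons inE => /predU1P[->|/LE//]; move: pU;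
      do 2!case: (_ \in U).
  by apply: LR => // q qes; apply: RE; rewrite mem_rcons inE qes orbT.
split=> // [q|R R_refl R_sym R_trans RE u v].
  rewrite mem_rcons inE => /predU1P[-> _ _|qes q1 q2]; rewrite !ffunE ?eqxx.
    by case: eqP.
  by rewrite (LE q).
have {}LR x y : L x = L y -> R x y.
  by apply: LR => // q qes; apply: RE; rewrite mem_rcons inE qes orbT.
have Rp : R p.1 p.2 by apply: RE; rewrite ?mem_rcons ?mem_head.
rewrite !ffunE; case: (L u =P L p.1) => [/LR up|_];
  case: (L v =P L p.1) => [/LR vp|_].
- by move=> _; apply: (R_trans p.1) => //; rewrite R_sym.
- by move=> /LR pv; apply: (R_trans p.1) => //; apply: (R_trans p.2).
- move=> /LR up; apply: (R_trans p.2) => //; rewrite R_sym.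
  by apply: (R_trans p.1).
- exact: LR.
Qed.

Lemma barrier_sound (G : sgraph n) k c es : edge_stream G es ->
  result barrier_scanner k c es -> MaxMatching_le G k.
Proof.
move=> Ges; rewrite barrier_resultE /=; set U := set_of_word (word n.+1 c 0).
have := barrier_streamP c es
  (if k is Posz m then Some (inord (minn m n)) else None).
rewrite -/U; case: (stream_state _ _ _) => [L k'] [-> LE _]; case: k => // m.
rewrite inordK ?ltnS ?geq_minr //.
rewrite /MaxMatching_le lez_nat; have [M mM <-] := matching_numberP G.
have /(leq_odd_classes mM) : forall u v, u \notin U -> v \notin U ->
    [set u; v] \in edges G -> L u = L v.
  (* The stream may list the ends of the edge in either order. *)
  move=> u v uU vU; rewrite -(mem_stream Ges) => /mapP[[x y] pes /= eq_uv].
  have in_xy w : w \in [set u; v] -> w = x \/ w = y by rewrite eq_uv => /set2P.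
  have [xU yU] : x \notin U /\ y \notin U.
    have in_uv w : w \in ends (x, y) -> w \notin U.
      by rewrite -eq_uv => /set2P[]->.
    by rewrite !in_uv ?set21 ?set22.
  have Lxy := LE _ pes xU yU.
  by case: (in_xy u (set21 u v)) => ->; case: (in_xy v (set22 u v)) => ->.
move: (odd_classes _ _) #|U| #|M| => o a b; lia.
Qed.

Definition barrier_prover (G : sgraph n) (k : int) : seq bool :=
  let U := xchoose (barrier_exists G) in
  let mask (_ : nat) :=
    [tuple if insub (val v) is Some u then u \in U else false | v < n.+1] in
  of_words 1 mask.

Lemma barrier_prover_set (G : sgraph n) k :
  set_of_word (word n.+1 (barrier_prover G k) 0) = xchoose (barrier_exists G).
Proof.
set U := xchoose _; apply/setP => v;
  rewrite inE /barrier_prover word_of_words ltn0Sn.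
have lt_v : v < n.+1 by rewrite ltnS ltnW.
by rewrite -[v : nat]/(val (Ordinal lt_v)) -tnth_nth tnth_mktuple /= (valK v).
Qed.

Lemma barrier_complete (G : sgraph n) k : MaxMatching_le G k ->
  forall es, edge_stream G es ->
    result barrier_scanner k (barrier_prover G k) es.
Proof.
rewrite /MaxMatching_le; case: k => // m; rewrite lez_nat => le_m es Ges.
rewrite barrier_resultE /=; set c := barrier_prover G m.
have := barrier_streamP c es (Some (inord (minn m n))).
rewrite barrier_prover_set; set U := xchoose _.
case: (stream_state _ _ _) => [L k'] [-> _ LR].
have := leq_barrier (L := L) (xchooseP (barrier_exists G) : barrier G U).
rewrite inordK ?ltnS ?geq_minr //.
(* For a threshold at least [n], the clipped value is [n] and the test holds because [#|U| <= n]. *)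
case: (leqP n m) => [le_nm _|lt_mn /(_ _)].
  have : #|U| <= n by rewrite -[leqRHS]card_ord max_card.
  by move: #|U| (odd_classes _ _) => a o; lia.
move=> le; apply: leq_trans (le _) _; last by rewrite leq_add2r leq_double.
move=> R R_refl R_sym R_trans RE; apply: LR => // p pes p1 p2.
by apply: RE => //; rewrite -(mem_stream Ges) -/(ends p) map_f.
Qed.

End Barrier.

(** * Space bounds *)

Lemma up_log_exp a m : up_log 2 (a ^ m) <= m * up_log 2 a.
Proof.
elim: m => [|m IHm]; first by rewrite up_log1.
by rewrite expnS mulSn (leq_trans (up_logM _ _)) // leq_add2l.
Qed.

Lemma up_logS n : up_log 2 n.+1 <= (log2 n).+1.
Proof. by rewrite up_log_min // trunc_log_ltn. Qed.

Lemma up_logSM a b : up_log 2 (a * b).+1 <= up_log 2 a.+1 + up_log 2 b.+1.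
Proof. by apply: leq_trans (up_logM _ _); apply: leq_up_log; lia. Qed.

Lemma log2_leq n : log2 n <= n.
Proof.
by rewrite -{2}(trunc_expnK (p := 2) n) // leq_trunc_log // ltnW // ltn_expl.
Qed.

Lemma log2_gt0 n : 1 < n -> 0 < log2 n.
Proof. by move=> n1; rewrite trunc_log_gt0. Qed.

Lemma up_log_SS n : up_log 2 n.+2 <= (log2 n).+2.
Proof.
apply: leq_trans (_ : up_log 2 (2 * n.+1) <= _); last first.
  by apply: leq_trans (up_logM _ _) _; rewrite up_lognn // add1n ltnS up_logS.
by apply: leq_up_log; lia.
Qed.

(** The counter, the pending edge, one word, and a position among [n] words of [O(log n)] bits each
    take [O(log n)] bits; [1 < n] makes [log2 n] positive and absorbs the additive constants. *)
Lemma edge_list_space n : 1 < n ->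
  up_log 2 #|memory (edge_list_scanner n)| <= 23 * log2 n.
Proof.
move=> /log2_gt0 l_gt0; apply: leq_trans (up_log_memory _) _.
rewrite /= card_ord card_option card_bool card_prod card_ord.
set w := up_log 2 (n * n); have := up_log_SS n; have := up_logSM n n;
  have := up_logSM n w.+1.
have : w <= (log2 n).*2.+2.
  apply: leq_trans (up_logM n n) _; have := leq_up_log 2 (leqnSn n);
    have := up_logS n; lia.
have : up_log 2 w.+2 <= w.+1.
  by rewrite up_log_min // ltn_expl.
have -> : up_log 2 3 = 2 by [].
have := up_logS n; lia.
Qed.

(** The marked vertices and the buffered word take about [n] bits each; everything else is
    logarithmic. *)
Lemma coloring_space n : 1 < n ->
  up_log 2 #|memory (coloring_scanner n)| <= 20 * n.
Proof.
move=> n_gt1; apply: leq_trans (up_log_memory _) _.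
rewrite /= !card_prod card_ord card_bool -cardsT -powersetT card_powerset
  cardsT card_ord.
have := up_logM (2 ^ n * 2) n.+2; have := up_logM (2 ^ n) 2;
  rewrite up_expnK //.
have -> : up_log 2 2 = 1 by [].
have := up_logSM n n; have := up_logSM n.+2 n.+1.
have := up_log_SS n; have := up_log_SS n.+1; have := up_logS n.
have := log2_leq n; have := log2_leq n.+1; lia.
Qed.

(** The [n] labels, of about [log2 n] bits each, dominate. *)
Lemma barrier_space n : 1 < n ->
  up_log 2 #|memory (barrier_scanner n)| <= 23 * (n * log2 n).
Proof.
move=> n_gt1; have l_gt0 := log2_gt0 n_gt1;
  apply: leq_trans (up_log_memory _) _.
rewrite /= card_prod card_option card_ffun card_tuple card_bool !card_ord
  up_expnK //.
have := up_logM (n ^ n) n.+2; have := up_log_exp n n.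
have : n * up_log 2 n <= n * (log2 n).+1.
  by rewrite leq_mul2l (leq_trans _ (up_logS n)) ?orbT // leq_up_log.
have := up_logSM n n; have := up_logSM 1 n.+1.
have -> : up_log 2 2 = 1 by [].
have := up_log_SS n; have := up_logS n; have := log2_leq n.
have : n <= n * log2 n by rewrite leq_pmulr.
rewrite (mulnS n); move: (n * log2 n) (n * up_log 2 n) (up_log 2 (n ^ n)); lia.
Qed.

Theorem theorem3 :
  (exists S : scheme MaxMatching_ge,
     cert_size_O S (fun k => (1 <= k)%R) (fun n G k => `|k|%N * log2 n) /\
     space_O S (fun n => log2 n)) /\
  (exists S : scheme MaxMatching_ge,
     cert_size_O S (fun=> True) (fun n G k => n * log2 (max_degree G)) /\
     space_O S (fun n => n)) /\
  (exists S : scheme MaxMatching_le,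
     cert_size_O S (fun=> True) (fun n G k => n) /\
     space_O S (fun n => n * log2 n)).
Proof.
split; [|split].
- exists (scanner_scheme edge_list_complete edge_list_sound); split; last first.
    by exists 23 => n; apply: edge_list_space.
  (* A word has at most [2 * log2 n + 3] bits, and [log2 n] is at least 1. *)
  exists 5 => n G [m|//] n_gt1 _ _; rewrite /= size_of_words card_prod card_ord.
  have := up_logM n n; have := leq_up_log 2 (leqnSn n); have := up_logS n.
  have := log2_gt0 n_gt1 => l_gt0 le1 le2 le3.
  by rewrite mulnCA leq_mul2l; apply/orP; right; lia.
- exists (scanner_scheme coloring_complete coloring_sound); split; last first.
    by exists 20 => n; apply: coloring_space.
  (* For [Delta <= 1] the certificate is empty. Otherwise the factor 6 comes from
     [log2 Delta + 2 <= 3 * log2 Delta] and [n + 1 <= 2 * n]. *)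
  exists 6 => n G k n_gt1 _ _; rewrite /= size_of_words /color_bits.
  case: (leqP _ 1) => // /log2_gt0 l_gt0.
  have : (log2 (max_degree G)).+2 * n.+1 <= (3 * log2 (max_degree G)) * (2 * n).
    by rewrite leq_mul //; lia.
  by rewrite mulnACA (mulnC n).
- exists (scanner_scheme barrier_complete barrier_sound); split; last first.
    by exists 23 => n; apply: barrier_space.
  exists 2 => n G k n_gt1 _ _; apply: (@leq_trans (1 * n.+1)); last by lia.
  exact/eq_leq/size_of_words.
Qed.
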